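(* Let $R$ be a commutative ring with identity, let $M$ be a finitely generated comultiplication $R$-module, and let $S$ be a second submodule of $M$. Then $S$ is a maximal second submodule of $M$ if and only if $S=\mathrm{sec}\big(I^M_{\mathrm{Ann}_R(S)}(M)\big)$. In particular, if $M$ is a coreduced $R$-module, then $S$ is a maximal second submodule of $M$ if and only if $S=I^M_{\mathrm{Ann}_R(S)}(M)$.
   Context: For a submodule $N$ of $M$, $r\in R$ and an ideal $I$ of $R$: $(N:_R M)=\{r\in R: rM\subseteq N\}$, $(N:_M I)=\{m\in M: Im\subseteq N\}$, $(N:_M r)=\{m\in M: rm\in N\}$. $M$ is a comultiplication module if for every submodule $N$ of $M$ there is an ideal $I$ of $R$ with $N=(0:_M I)$. A proper submodule $N$ of $M$ is completely irreducible if $N=\bigcap_{i\in I}N_i$, for a family $\{N_i\}_{i\in I}$ of submodules of $M$, implies $N=N_i$ for some $i$. $M$ is coreduced if for every $r\in R$ and every completely irreducible submodule $L$ of $M$, $(L:_M r)=M$ implies $L+(0:_M r)=M$. A non-zero submodule $N$ of $M$ is second if for each $a\in R$ the multiplication map $N\xrightarrow{a}N$ is either surjective or zero. A second submodule $N$ of $M$ is a maximal second submodule of $M$ if there is no second submodule $L$ of $M$ with $N\subsetneq L\subseteq M$. $\mathrm{sec}(N)$ is the sum of all second submodules of $M$ contained in $N$ (zero if there are none). For a second submodule $S$ of $M$, $I^M_{\mathrm{Ann}_R(S)}(M)$ is the intersection of all completely irreducible submodules $L$ of $M$ with $(L:_R M)\not\subseteq \mathrm{Ann}_R(S)$ (the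 empty intersection being $M$). *)

(* Defs.v *)
From HB Require Import structures.
From mathcomp Require Import all_boot all_algebra.
From mathcomp Require Import boolp classical_sets functions.

Set Implicit Arguments.
Unset Strict Implicit.
Unset Printing Implicit Defensive.

Import GRing.Theory.
Local Open Scope ring_scope.
Local Open Scope classical_set_scope.

Section Submodules.
Context {R : comPzRingType} {M : lmodType R}.
Implicit Types (N K L S : set M) (r a : R).

Definition is_submodule N : Prop := GRing.submod_closed [in N].

(* Finite sums of elements of the members of F; {0} when F is empty. *)
Definition submod_sum (F : set (set M)) : set M :=
  [set x | exists s : seq M,
    (forall y, y \in s -> (\bigcup_(N in F) N) y) /\ x = \sum_(y <- s) y].

Definition finitely_generated : Prop :=
  exists (n : nat) (g : 'I_n -> M),
    forall x : M, exists c : 'I_n -> R, x = \sum_(i < n) c i *: g i.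

(* (N :_R K); the residual (N :_R M) is the case K = setT. *)
Definition colon_ring N K : set R := [set r | forall m, K m -> N (r *: m)].

Definition Ann K : set R := colon_ring [set 0] K.

(* (N :_M I) *)
Definition colon_ideal N (I : set R) : set M :=
  [set m | forall r, I r -> N (r *: m)].

(* (N :_M r) *)
Definition colon_elt N r : set M := [set m | N (r *: m)].

End Submodules.

Arguments finitely_generated {R} M.

(* Ideals are the submodules of the regular module; unlike idealr_closed,
   this admits the unit ideal. *)
Definition is_ideal (R : comPzRingType) (I : set R) : Prop :=
  is_submodule (I : set R^o).

Definition comultiplication (R : comPzRingType) (M : lmodType R) : Prop :=
  forall N : set M, is_submodule N ->
    exists I : set R, is_ideal I /\ N = colon_ideal [set 0] I.

Section Second.
Context {R : comPzRingType} {M : lmodType R}.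
Implicit Types (N L S : set M).

Definition completely_irreducible N : Prop :=
  [/\ is_submodule N, N <> setT &
    forall (J : Type) (F : J -> set M), (forall j, is_submodule (F j)) ->
      N = \bigcap_j F j -> exists j, N = F j].

Definition is_second N : Prop :=
  [/\ is_submodule N, N <> [set 0] &
    forall a : R, set_surj N N (fun x => a *: x) \/
                  (forall x, N x -> a *: x = 0)].

Definition maximal_second N : Prop :=
  is_second N /\ ~ (exists L, is_second L /\ N `<` L).

Definition sec N : set M := submod_sum [set T | is_second T /\ T `<=` N].

(* I^M_p(M) *)
Definition ci_inter (p : set R) : set M :=
  \bigcap_(L in [set L | completely_irreducible L /\
                         ~ (colon_ring L setT `<=` p)]) L.

End Second.

Arguments ci_inter {R} M p.

Definition coreduced (R : comPzRingType) (M : lmodType R) : Prop :=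
  forall (r : R) (L : set M), completely_irreducible L ->
    colon_elt L r = setT ->
    [set x + y | x in L & y in colon_elt [set 0] r] = setT.

(* Main.v *)
Require Import Defs.
From mathcomp Require Import all_boot all_algebra.
From mathcomp Require Import boolp classical_sets functions.
From mathcomp Require Import ring.

(** Write p for Ann S.  In a comultiplication module every submodule N equals
    (0 :_M Ann N), so inclusions of submodules are the reversed inclusions of
    their annihilators, and the second submodules are governed by their
    annihilators, which are prime ideals containing Ann M.

    Finite generation makes every prime q containing Ann M occur: (0 :_M q) is
    second with annihilator exactly q ([Ann_torsion_prime], [second_torsion]).
    Indeed q contains Ann x for one of the finitely many generators x, and the
    comultiplication property of the cyclic module Rx, applied to its submodule
    qx, shows that what kills (0 :_M q) lies in q.  Hence S is a maximal second
    submodule exactly when p is a minimal prime over Ann M, and then every r in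
    p satisfies s * r ^+ n \in Ann M for some n and some s outside p
    ([maximal_second_local_nilpotent]).

    On the other side, every submodule is an intersection of completely
    irreducible ones, so that I^M_p(M) is contained in sM for all s outside p.
    If T is a second submodule of I^M_p(M), r is in p and s * r ^+ n kills M,
    then r ^+ n kills sM, which contains T, so r is in the prime Ann T; thus p
    is contained in Ann T, that is, T is contained in S.  If M is coreduced,
    Ann M is a radical ideal, so s * r already kills M; therefore all of
    I^M_p(M) is killed by p and is contained in S.

    Conversely every second T containing S satisfies sT = T for s outside p,
    and therefore lies in I^M_p(M). *)

Set Implicit Arguments.
Unset Strict Implicit.
Unset Printing Implicit Defensive.

Import GRing.Theory.
Local Open Scope ring_scope.
Local Open Scope classical_set_scope.

(** * Submodules *)

Section Submodules.
Context {R : comPzRingType} {M : lmodType R}.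
Implicit Types (N L S T U : set M) (r a s : R) (x y : M).

Lemma scalerC a s x : a *: (s *: x) = s *: (a *: x).
Proof. by rewrite !scalerA mulrC. Qed.

Lemma is_submoduleP N :
  is_submodule N <->
  N 0 /\ forall a x y, N x -> N y -> N (a *: x + y).
Proof.
split=> [[N0 Nlin]|[N0 Nlin]].
  split=> [|a x y Nx Ny]; first exact: set_mem N0.
  by apply: set_mem; apply: Nlin; exact: mem_set.
split; first exact: mem_set.
by move=> a x y /set_mem Nx /set_mem Ny; apply: mem_set; exact: Nlin.
Qed.

Lemma submodule0 N : is_submodule N -> N 0.
Proof. by case/is_submoduleP. Qed.

Lemma submoduleD N x y : is_submodule N -> N x -> N y -> N (x + y).
Proof. by case/is_submoduleP=> _ Nlin Nx Ny; rewrite -[x]scale1r; exact: Nlin. Qed.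

Lemma submoduleZ N a x : is_submodule N -> N x -> N (a *: x).
Proof. by case/is_submoduleP=> N0 Nlin Nx; rewrite -[_ *: _]addr0; exact: Nlin. Qed.

Lemma submodule_sum N (s : seq M) : is_submodule N ->
  (forall y, y \in s -> N y) -> N (\sum_(y <- s) y).
Proof.
move=> subN sN; rewrite big_seq; apply: big_ind => //.
- exact: submodule0.
- by move=> x y; exact: submoduleD.
Qed.

Lemma submodule_colon_ideal (I : set R) :
  is_submodule (colon_ideal [set 0] I : set M).
Proof.
apply/is_submoduleP; split=> [r _|a x y Ix Iy r Ir] /=; first by rewrite scaler0.
by rewrite scalerDr scalerC (Ix r Ir) (Iy r Ir) scaler0 addr0.
Qed.

Lemma submodule_image_scale N a :
  is_submodule N -> is_submodule [set a *: y | y in N].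
Proof.
move=> subN; apply/is_submoduleP; split.
  by exists 0; [exact: submodule0 | rewrite scaler0].
move=> b _ _ [x Nx <-] [y Ny <-]; exists (b *: x + y).
  by apply: submoduleD => //; exact: submoduleZ.
by rewrite scalerDr scalerC.
Qed.

Lemma submodule_setT : is_submodule [set: M].
Proof. exact/is_submoduleP. Qed.

Lemma submodule_add_line N x :
  is_submodule N -> is_submodule [set y + a *: x | y in N & a in [set: R]].
Proof.
move=> subN; apply/is_submoduleP; split.
  by exists 0; [exact: submodule0 | exists 0 => //; rewrite scale0r addr0].
move=> b _ _ [y Ny [a _ <-]] [z Nz [c _ <-]].
exists (b *: y + z); first by apply: submoduleD => //; exact: submoduleZ.
by exists (b * a + c) => //; rewrite scalerDl scalerDr scalerA addrACA.
Qed.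

(** The common source of completely irreducible submodules ([U] a singleton)
    and of prime ideals ([U] multiplicatively closed). *)
Lemma exists_maximal_avoiding N U : is_submodule N -> N `&` U = set0 ->
  exists L, [/\ is_submodule L, N `<=` L, L `&` U = set0 &
    forall K, is_submodule K -> L `<=` K -> K `&` U = set0 -> K `<=` L].
Proof.
move=> subN NU.
(* The union with N keeps the union of the empty chain among the candidates. *)
pose P := [set X : set M | is_submodule (X `|` N) /\ (X `|` N) `&` U = set0].
have [F FP totF|A [[subA AU] maxA]] := @Zorn_bigcup M P.
  have inF x y : (\bigcup_(X in F) X `|` N) x -> (\bigcup_(X in F) X `|` N) y ->
      (N x /\ N y) \/ exists X, [/\ F X, (X `|` N) x & (X `|` N) y].
    case=> [[X FX Xx]|Nx] [[Y FY Yy]|Ny].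
    - right; have [XY|YX] := totF X Y FX FY.
        by exists Y; split=> //; left => //; exact: XY.
      by exists X; split=> //; left => //; exact: YX.
    - by right; exists X; split=> //; [left | right].
    - by right; exists Y; split=> //; [right | left].
    - by left.
  split.
    apply/is_submoduleP; split; first by right; exact: submodule0.
    move=> a x y Fx Fy; have [[Nx Ny]|[X [FX Xx Xy]]] := inF x y Fx Fy.
      by right; apply: submoduleD => //; exact: submoduleZ.
    have [/is_submoduleP[_ /(_ a x y Xx Xy)] [Xz|Nz] _] := FP X FX.
      by left; exists X.
    by right.
  apply/seteqP; split=> // x [[[X FX Xx]|Nx] Ux].
    by have [_ <-] := FP X FX; split=> //; left.
  by rewrite -NU.
exists (A `|` N); split=> // K subK AK KU x Kx; apply: contrapT => notAx.
have NK : K `|` N = K by apply/setUidPl => y Ny; apply: AK; right.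
apply: (maxA K); last by rewrite /P /= NK.
split; first by move=> y Ay; apply: AK; left.
by move=> KA; apply: notAx; left; exact: KA.
Qed.

(** A submodule maximal among those avoiding a given [x] is completely
    irreducible: all strictly larger submodules contain [x], and so does their
    intersection. *)
Lemma exists_completely_irreducible N x : is_submodule N -> ~ N x ->
  exists L, [/\ completely_irreducible L, N `<=` L & ~ L x].
Proof.
move=> subN notNx.
have NU : N `&` [set x] = set0.
  by apply/seteqP; split=> // y [Ny /= yx]; apply: notNx; rewrite -yx.
have [L [subL NL LU maxL]] := exists_maximal_avoiding subN NU.
have notLx : ~ L x by move=> Lx; rewrite -[False]/(set0 x) -LU.
exists L; split=> //; split=> //; first by move=> LT; apply: notLx; rewrite LT.
move=> J F subF LF; apply: contrapT => notF; apply: notLx.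
rewrite LF => j _; apply: contrapT => notFx; apply: notF; exists j.
have LFj : L `<=` F j by rewrite LF => y /(_ j I).
apply/seteqP; split=> //; apply: maxL => //.
by apply/seteqP; split=> // y [Fy /= yx]; apply: notFx; rewrite -yx.
Qed.

Lemma ci_inter_sub_scale (p : set R) s : ~ p s ->
  ci_inter M p `<=` [set s *: y | y in setT].
Proof.
move=> notps x Ix; apply: contrapT => notsx.
have subs := submodule_image_scale s submodule_setT.
have [L [ciL sL notLx]] := exists_completely_irreducible subs notsx.
apply: notLx; apply: Ix; split=> // Lp; apply: notps; apply: Lp => m _.
by apply: sL; exists m.
Qed.

(** If (0 :_M r) were proper, a completely irreducible submodule containing it
    would contain rM, as r ^+ 2 kills M, and its sum with (0 :_M r) would not
    be M. *)
Lemma coreduced_sqr r : coreduced M ->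
  (forall x, r *: (r *: x) = 0) -> forall x, r *: x = 0.
Proof.
move=> coredM r2M x; apply: contrapT => rx.
have subr : is_submodule (colon_elt [set 0] r : set M).
  rewrite /colon_elt; apply/is_submoduleP; split=> [|a y z /= ry rz] /=.
    by rewrite scaler0.
  by rewrite scalerDr scalerC ry rz scaler0 addr0.
have [L [ciL rL notLx]] := exists_completely_irreducible subr rx.
have /(_ r L ciL) := coredM; case: (ciL) => subL _ _.
have -> : colon_elt L r = setT by apply/seteqP; split=> // y _; exact/rL/r2M.
move=> /(_ erefl) LT; apply: notLx.
have : [set: M] x by [].
by rewrite -LT => -[y Ly [z rz <-]]; apply: submoduleD => //; exact: rL.
Qed.

Lemma coreduced_expn r n : coreduced M ->
  (forall x, r ^+ n *: x = 0) -> forall x, r *: x = 0.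
Proof.
move=> coredM; elim: n => [|n IHn] rM.
  by move=> x; rewrite -[_ *: _]scale1r -[1]/(r ^+ 0) rM.
case: n => [|n] in IHn rM *; first by move=> x; rewrite -[r]expr1 rM.
apply: IHn; apply: coreduced_sqr => // x.
by rewrite scalerA -exprD addSnnS exprD -scalerA rM scaler0.
Qed.

End Submodules.

(** * Prime ideals *)

Section Primes.
Context {R : comPzRingType}.
Implicit Types (p q I U : set R) (a b r s : R).

Definition is_prime p : Prop :=
  [/\ is_ideal p, ~ p 1 & forall a b, p (a * b) -> p a \/ p b].

Lemma prime_exp p r n : is_prime p -> p (r ^+ n) -> p r.
Proof.
case=> _ p1 pM; elim: n => [/p1 //|n IHn].
by rewrite exprS => /pM [|/IHn].
Qed.

Lemma prime_prod p (n : nat) (a : 'I_n -> R) : is_prime p ->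
  p (\prod_(i < n) a i) -> exists i, p (a i).
Proof.
move=> [_ p1 pM] pa; apply: contrapT => nopa; move: pa.
apply: (big_ind (fun x => ~ p x)) => //.
- by move=> x y px py /pM [].
- by move=> i _ pai; apply: nopa; exists i.
Qed.

(** An ideal maximal among those avoiding [U] is prime: if it contained neither
    [a] nor [b], adjoining each would reach [U], and so would the product of
    the two elements reached, which is a multiple of [a * b] modulo it. *)
Lemma exists_prime_avoiding I U : is_ideal I -> I `&` U = set0 ->
  U 1 -> (forall a b, U a -> U b -> U (a * b)) ->
  exists q, [/\ is_prime q, I `<=` q & q `&` U = set0].
Proof.
move=> idI IU U1 UM.
have [q [subq Iq qU maxq]] := exists_maximal_avoiding (M := R^o) idI IU.
have qUF x : q x -> U x -> False by move=> qx Ux; rewrite -[False]/(set0 x) -qU.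
exists q; split=> //; split=> //; first by move=> q1; exact: (qUF 1).
move=> a b qab; apply: contrapT => /not_orP [notqa notqb].
have meetU c : ~ q c -> exists y d, q y /\ U (y + d * c).
  move=> notqc; apply: contrapT => notU; apply: notqc.
  apply: (maxq _ (submodule_add_line (c : R^o) subq)).
  - by move=> y qy; exists y => //; exists 0 => //; rewrite scale0r addr0.
  - apply/seteqP; split=> // _ [[y qy [d _ <-]] Uyd].
    by apply: notU; exists y, d.
  - by exists 0; [exact: submodule0 subq | exists 1 => //; rewrite scale1r add0r].
have [y [d [qy Uyd]]] := meetU a notqa; have [z [e [qz Uze]]] := meetU b notqb.
apply: qUF (UM _ _ Uyd Uze).
have -> : (y + d * a) * (z + e * b) =
    (z + e * b) * y + ((d * a) * z + (d * e) * (a * b)) by ring.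
have qZ c x : q x -> q (c * x) by exact: (submoduleZ c subq).
apply: (submoduleD subq); first exact: qZ.
by apply: (submoduleD subq); exact: qZ.
Qed.

End Primes.

(** * Second submodules *)

Section Annihilators.
Context {R : comPzRingType} {M : lmodType R}.
Implicit Types (N L S T : set M) (r a s : R) (x y : M) (p q : set R).

Lemma ideal_Ann N : is_ideal (Ann N).
Proof.
apply/is_submoduleP; split=> [m _|a r s rN sN m Nm] /=; first by rewrite scale0r.
by rewrite scalerDl -scalerA (rN m Nm) (sN m Nm) scaler0 addr0.
Qed.

Lemma second_scale_surj S s : is_second S -> ~ Ann S s ->
  forall x, S x -> exists2 y, S y & s *: y = x.
Proof. by move=> [_ _ /(_ s)] [sS _|sS /(_ sS)]. Qed.

Lemma prime_Ann_second S : is_second S -> is_prime (Ann S).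
Proof.
move=> secS; have [subS S0 _] := secS; split; first exact: ideal_Ann.
  move=> S1; apply: S0; apply/seteqP; split=> [x Sx|_ ->].
    by have := S1 x Sx; rewrite /= scale1r.
  exact: submodule0.
move=> a b abS; apply: contrapT => /not_orP [notSa notSb].
apply: notSa => x Sx.
by have [y Sy <-] := second_scale_surj secS notSb Sx; rewrite scalerA; exact: abS.
Qed.

(** A scalar [s] outside [p] acts surjectively on [T], so [T] lies in sM, hence
    in every submodule containing sM. *)
Lemma second_sub_ci_inter T p : is_second T -> Ann T `<=` p ->
  T `<=` ci_inter M p.
Proof.
move=> secT Tp x Tx L [ciL notLp].
have [s [sL notps]] : exists s, colon_ring L setT s /\ ~ p s.
  apply: contrapT => nos; apply: notLp => s sL.
  by apply: contrapT => notps; apply: nos; exists s.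
have [y _ <-] := second_scale_surj secT (contra_not (Tp s) notps) Tx.
exact: sL.
Qed.

(** The element [x] is one of the generators: the product of their annihilators
    kills M, so it lies in the prime [q], and so does one of the factors. *)
Lemma prime_sup_Ann_elt q : finitely_generated M -> is_prime q ->
  Ann [set: M] `<=` q -> exists x : M, Ann [set x] `<=` q.
Proof.
move=> [n [g gM]] primeq Mq.
have [[i giq]|nogen] := pselect (exists i, Ann [set g i] `<=` q).
  by exists (g i).
have /choice [a aP] : forall i, exists a, Ann [set g i] a /\ ~ q a.
  move=> i; apply: contrapT => noa; apply: nogen; exists i => a ag.
  by apply: contrapT => nqa; apply: noa; exists a.
have [|i qai] := @prime_prod _ q n a primeq; last by have [] := aP i.
apply: Mq => m _ /=; have [c ->] := gM m.
rewrite scaler_sumr big1 // => i _.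
rewrite (bigD1 i) //= scalerC mulrC -scalerA.
by have [/(_ (g i) erefl) /= -> _] := aP i; rewrite !scaler0.
Qed.

Context (comultM : comultiplication M).

Lemma comultiplication_Ann N x : is_submodule N ->
  (forall r, Ann N r -> r *: x = 0) -> N x.
Proof.
move=> subN xN; have [I [_ NI]] := comultM subN; rewrite NI => r Ir.
by apply: xN => m; rewrite NI => /(_ r Ir).
Qed.

Lemma comultiplication_sub N T : is_submodule N -> Ann N `<=` Ann T ->
  T `<=` N.
Proof. by move=> subN NT x Tx; apply: comultiplication_Ann => // r /NT; apply. Qed.

(** Choose [x] with Ann x contained in [q].  If [a] kills (0 :_M q), it kills
    [r *: x] for all [r] in Ann(qx), so [a *: x] is in qx by comultiplication;
    therefore [a] is in [q + Ann x], that is, in [q]. *)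
Lemma Ann_torsion_prime q : finitely_generated M -> is_prime q ->
  Ann [set: M] `<=` q -> Ann (colon_ideal [set 0] q : set M) = q.
Proof.
move=> fgM primeq Mq; have [idq _ _] := primeq.
apply/seteqP; split=> [a aq|a qa m qm]; last exact: qm.
have [x xq] := prime_sup_Ann_elt fgM primeq Mq.
have subqx : is_submodule [set b *: x | b in q].
  apply/is_submoduleP; split.
    by exists 0; [exact: (submodule0 idq) | rewrite scale0r].
  move=> c _ _ [b qb <-] [d qd <-]; exists (c * b + d).
    by apply: (submoduleD idq) => //; exact: (submoduleZ c idq).
  by rewrite scalerDl scalerA.
have [r rqx|b qb bax] := @comultiplication_Ann _ (a *: x) subqx.
  rewrite scalerC; apply: aq => b qb /=.
  by rewrite scalerC; apply: rqx; exists b.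
rewrite -(subrK b a); apply: (submoduleD idq) => //; apply: xq => _ ->.
by rewrite /= scalerBl bax subrr.
Qed.

(** For [a] outside [q] the submodules aN and N, with N = (0 :_M q), have the
    same annihilator, as (q : a) = q; so they coincide. *)
Lemma second_torsion q : finitely_generated M -> is_prime q ->
  Ann [set: M] `<=` q -> is_second (colon_ideal [set 0] q : set M).
Proof.
move=> fgM primeq Mq; have AnnE := Ann_torsion_prime fgM primeq Mq.
have [idq q1 qM] := primeq; set N := colon_ideal _ _ in AnnE *.
have subN : is_submodule N by exact: submodule_colon_ideal.
split=> // [N0|a]; first by apply: q1; rewrite -AnnE N0 => _ ->; rewrite /= scaler0.
have [qa|notqa] := pselect (q a); first by right=> x; apply.
left; apply: (comultiplication_sub (submodule_image_scale a subN)) => r raN.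
rewrite AnnE.
have [|//|//] := qM r a; rewrite -AnnE => m Nm /=.
by rewrite -scalerA; apply: raN; exists m.
Qed.

(** Minimality of the prime [Ann S] over [Ann M], in the form used below.  A
    prime over [Ann M] avoiding all the [s * r ^+ n] with [s] outside [Ann S]
    would lie strictly inside [Ann S], and the elements of M that it kills would
    form a larger second submodule. *)
Lemma maximal_second_local_nilpotent S r : finitely_generated M ->
  maximal_second S -> Ann S r ->
  exists s n, ~ Ann S s /\ Ann [set: M] (s * r ^+ n).
Proof.
move=> fgM [secS maxS] Sr; have [subS _ _] := secS.
have [idS S1 SM] := prime_Ann_second secS.
pose U := [set t | exists s n, ~ Ann S s /\ t = s * r ^+ n].
apply: contrapT => noS.
have [||a b [s [n [Ss ->]]] [t [m [St ->]]]|q [primeq Mq qU]] :=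
    exists_prime_avoiding (U := U) (ideal_Ann [set: M]).
- apply/seteqP; split=> // t [Mt [s [n [Ss tE]]]].
  by apply: noS; exists s, n; rewrite -tE.
- by exists 1, 0%N; rewrite mulr1.
- exists (s * t), (n + m)%N; split; first by move=> /SM [].
  by rewrite exprD mulrACA.
have qUF t : q t -> U t -> False by move=> qt Ut; rewrite -[False]/(set0 t) -qU.
have AnnE := Ann_torsion_prime fgM primeq Mq.
have notqr : ~ q r.
  by move=> qr; apply: (qUF r) => //; exists 1, 1%N; rewrite mul1r expr1.
apply: maxS; exists (colon_ideal [set 0] q); split; first exact: second_torsion.
split=> [|qS].
  apply: comultiplication_sub; first exact: submodule_colon_ideal.
  rewrite AnnE => t qt; apply: contrapT => St.
  by apply: (qUF t) => //; exists t, 0%N; rewrite mulr1.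
by apply: notqr; rewrite -AnnE => m /qS; exact: Sr.
Qed.

Lemma second_sub_ci_inter_maximal S T : finitely_generated M ->
  maximal_second S -> is_second T -> T `<=` ci_inter M (Ann S) -> T `<=` S.
Proof.
move=> fgM maxS secT TI; have [[subS _ _] _] := maxS.
apply: comultiplication_sub => // r Sr.
have [s [n [Ss Msr]]] := maximal_second_local_nilpotent fgM maxS Sr.
apply: (@prime_exp _ _ _ n (prime_Ann_second secT)) => x Tx /=.
have [y _ <-] := ci_inter_sub_scale Ss (TI x Tx).
by rewrite scalerA mulrC; exact: Msr.
Qed.

Lemma coreduced_ci_inter_maximal S : finitely_generated M -> coreduced M ->
  maximal_second S -> ci_inter M (Ann S) `<=` S.
Proof.
move=> fgM coredM maxS; have [[subS _ _] _] := maxS.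
apply: comultiplication_sub => // r Sr x Ix /=.
have [s [n [Ss Msr]]] := maximal_second_local_nilpotent fgM maxS Sr.
have [y _ <-] := ci_inter_sub_scale Ss Ix; rewrite scalerA.
(* The exponent n would not do: for n = 0 the power is 1. *)
apply: (coreduced_expn (n := n.+1)) => // z.
have -> : (r * s) ^+ n.+1 = s ^+ n * r * (s * r ^+ n).
  by rewrite exprMn !exprS; ring.
by rewrite -scalerA (Msr z I) scaler0.
Qed.

Lemma maximal_second_of_bound S : is_second S ->
  (forall T, is_second T -> T `<=` ci_inter M (Ann S) -> T `<=` S) ->
  maximal_second S.
Proof.
move=> secS bound; split=> // -[T [secT [ST notTS]]]; apply: notTS.
apply: bound => //; apply: second_sub_ci_inter => // r rT m Sm.
exact/rT/ST.
Qed.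

Lemma second_sub_sec T N : is_second T -> T `<=` N -> T `<=` sec N.
Proof.
move=> secT TN x Tx; exists [:: x]; rewrite big_seq1; split=> // y.
by rewrite mem_seq1 => /eqP ->; exists T.
Qed.

Lemma sec_sub S N : is_submodule S ->
  (forall T, is_second T -> T `<=` N -> T `<=` S) -> sec N `<=` S.
Proof.
move=> subS bound x [s [sN ->]]; apply: submodule_sum => // y /sN.
by case=> T [secT TN]; exact: bound.
Qed.

End Annihilators.

Theorem corollary2p11 (R : comPzRingType) (M : lmodType R)
    (fgM : finitely_generated M) (comultM : comultiplication M)
    (S : set M) (secondS : is_second S) :
  (maximal_second S <-> S = sec (ci_inter M (Ann S))) /\
  (coreduced M -> (maximal_second S <-> S = ci_inter M (Ann S))).
Proof.
have [subS _ _] := secondS.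
have SI : S `<=` ci_inter M (Ann S) by exact: second_sub_ci_inter.
split=> [|coredM]; split=> [maxS|SE].
- apply/seteqP; split; first exact: second_sub_sec.
  by apply: sec_sub => // T; exact: second_sub_ci_inter_maximal.
- apply: maximal_second_of_bound => // T secT TI.
  by rewrite SE; exact: second_sub_sec.
- by apply/seteqP; split=> //; exact: coreduced_ci_inter_maximal.
- by apply: maximal_second_of_bound => // T _; rewrite -SE.
Qed.
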